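(* Let $A\subset\mathbb{R}^2$ be the union of the two closed disks of radius $1$ centered at $(-1,0)$ and $(1,0)$ (so that they are tangent at the origin). Then $L_1(A)<L_2(A)$, where $$L_1(A)=\sup\{\lambda\ge0:\mathrm{esc}(A,\partial A,\lambda)<0\},\qquad L_2(A)=\inf\{\lambda\ge 0:\mathrm{esc}(A,\partial A,\lambda)>0\}.$$
   Context: For $L\ge 0$, $P^L$ is the set of equivalence classes $[f]$ of $L$-Lipschitz maps $f:[0,1]\to\mathbb{R}^2$ up to reparameterization, rotation and translation (paths of length $\le L$). For compact $A\subset\mathbb{R}^2$, $\mathrm{dist}^+(A,\partial A,x)=\mathrm{dist}(x,\partial A)$ if $x\notin A$, and $=-\mathrm{dist}(x,\partial A)$ if $x\in A$. With $\mathrm{Isom}^+(\mathbb{R}^2)$ the group of orientation preserving isometries, $$\mathrm{con}(A,\partial A,f)=\max_{t\in[0,1]}\mathrm{dist}^+(A,\partial A,f(t)),\quad \mathrm{wcc}(A,\partial A,[f])=\min_{\sigma\in\mathrm{Isom}^+(\mathbb{R}^2)}\mathrm{con}(A,\partial A,\sigma\circ f),$$ $$\mathrm{esc}(A,\partial A,L)=\max_{[f]\in P^L}\mathrm{wcc}(A,\partial A,[f]).$$ *)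

(* Defs.v *)
From HB Require Import structures.
From mathcomp Require Import all_boot all_order all_algebra.
From mathcomp Require Import all_classical all_reals all_analysis.

Set Implicit Arguments.
Unset Strict Implicit.
Unset Printing Implicit Defensive.

Import Order.TTheory GRing.Theory Num.Theory.
Import numFieldNormedType.Exports.

Local Open Scope classical_set_scope.
Local Open Scope ring_scope.

(* Maxima and minima over infinite sets are written with sup and inf.  For a
   nonempty compact A and L >= 0 they are attained, so sup and inf are then the
   max and the min. *)

Section Escape.
Variable R : realType.

(* The library norm on R * R is the sup norm, whence an explicit Euclidean
   distance.  Both norms induce the same topology. *)
Definition plane : Type := (R * R)%type.

Definition edist2 (p q : plane) : R :=
  Num.sqrt ((p.1 - q.1) ^+ 2 + (p.2 - q.2) ^+ 2).

Definition cdisk (c : plane) (r : R) : set plane := [set p | edist2 c p <= r].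

Definition bnd (A : set (R * R)) : set (R * R) := closure A `\` A°.

Definition dist_set (x : plane) (B : set plane) : R :=
  inf [set edist2 x y | y in B].

Definition sdist (A : set plane) (x : plane) : R :=
  if x \in A then - dist_set x (bnd A) else dist_set x (bnd A).

(* Twice the signed area of the triangle p q r. *)
Definition orient (p q r : plane) : R :=
  (q.1 - p.1) * (r.2 - p.2) - (q.2 - p.2) * (r.1 - p.1).

Definition isom_plus : set (plane -> plane) :=
  [set s | [/\ bijective s,
               forall p q, edist2 (s p) (s q) = edist2 p q &
               forall p q r, Num.sg (orient (s p) (s q) (s r)) =
                             Num.sg (orient p q r)]].

(* Paths are total functions on R, of which only the restriction to [0, 1]
   matters; path_equiv ignores the values outside [0, 1]. *)
Definition lip (L : R) (f : R -> plane) : Prop :=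
  forall s t, `[0, 1]%classic s -> `[0, 1]%classic t ->
    edist2 (f s) (f t) <= L * `|s - t|.

Definition homeo01_with_inverse (phi psi : R -> R) : Prop :=
  [/\ set_fun `[0, 1] `[0, 1] phi, set_fun `[0, 1] `[0, 1] psi,
      (forall t, `[0, 1]%classic t -> psi (phi t) = t) /\
      (forall t, `[0, 1]%classic t -> phi (psi t) = t),
      {within `[0, 1], continuous phi} & {within `[0, 1], continuous psi}].

(* Equality up to reparameterization by a homeomorphism of [0, 1], rotation
   and translation; an orientation preserving isometry of the plane is a
   rotation followed by a translation. *)
Definition path_equiv (f g : R -> plane) : Prop :=
  exists phi psi s, [/\ homeo01_with_inverse phi psi, isom_plus s &
    forall t, `[0, 1]%classic t -> g t = s (f (phi t))].

Definition path_class (L : R) (f : R -> plane) : set (R -> plane) :=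
  [set g | lip L g /\ path_equiv f g].

Definition paths (L : R) : set (set (R -> plane)) :=
  [set path_class L f | f in lip L].

Definition con (A : set plane) (f : R -> plane) : R :=
  sup [set sdist A (f t) | t in `[0, 1]].

(* wcc of a class is computed on a chosen representative; by wccE below, any
   representative gives the same value. *)
Definition wcc (A : set plane) (c : set (R -> plane)) : R :=
  let f := get (c : set (R -> R * R)) in
  inf [set con A (s \o f) | s in isom_plus].

Definition esc (A : set plane) (L : R) : R :=
  sup [set wcc A c | c in paths L].

Definition L1 (A : set plane) : R := sup [set l | 0 <= l /\ esc A l < 0].

Definition L2 (A : set plane) : R := inf [set l | 0 <= l /\ 0 < esc A l].

Lemma isom_plus_id : isom_plus id.
Proof. by split => //; exists id. Qed.

Lemma isom_plus_comp s1 s2 :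
  isom_plus s1 -> isom_plus s2 -> isom_plus (s1 \o s2).
Proof.
move=> [b1 d1 o1] [b2 d2 o2]; split; first exact: bij_comp.
- by move=> p q /=; rewrite d1 d2.
- by move=> p q r /=; rewrite o1 o2.
Qed.

Lemma isom_plus_inv s : isom_plus s ->
  exists s', [/\ isom_plus s', cancel s s' & cancel s' s].
Proof.
move=> [[s' k1 k2] d o]; exists s'; split => //; split; first by exists s.
- by move=> p q; rewrite -d !k2.
- by move=> p q r; rewrite -o !k2.
Qed.

Lemma path_equiv_refl f : path_equiv f f.
Proof.
exists id, id, id; split => //; last exact: isom_plus_id.
by split => //; apply: continuous_subspaceT => x; exact: cvg_id.
Qed.

Lemma path_equiv_sym f g : path_equiv f g -> path_equiv g f.
Proof.
move=> [phi [psi [s [[m1 m2 [k1 k2] c1 c2] /isom_plus_inv[s' [i' e1 e2]] h]]]].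
exists psi, phi, s'; split => // t t01.
by rewrite h ?k2 ?e1//; exact: m2.
Qed.

Lemma path_equiv_trans f g h :
  path_equiv f g -> path_equiv g h -> path_equiv f h.
Proof.
move=> [phi [psi [s [[m1 m2 [k1 k2] c1 c2] i e]]]].
move=> [phi' [psi' [s' [[m1' m2' [k1' k2'] c1' c2'] i' e']]]].
have comp_cont (u v : R -> R) : set_fun `[0, 1] `[0, 1] u ->
    {within `[0, 1], continuous u} -> {within `[0, 1], continuous v} ->
    {within `[0, 1], continuous (v \o u)}.
  move=> mu cu cv; apply/subspace_continuousP => x x01 /=.
  move/subspace_continuousP: cu => /(_ x x01) cu.
  move/subspace_continuousP: cv => /(_ _ (mu _ x01)) cv.
  apply: cvg_trans cv => B /cu; rewrite /= !nbhs_simpl /=.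
  by apply: filterS2 (withinT _ _) => y y01; apply; exact: mu.
exists (phi \o phi'), (psi' \o psi), (s' \o s); split.
- split=> [t t01|t t01|||] /=.
  + exact/m1/m1'.
  + exact/m2'/m2.
  + split=> t t01 /=.
      by rewrite k1 ?k1'//; exact: m1'.
    by rewrite k2' ?k2//; exact: m2.
  + exact: comp_cont.
  + exact: comp_cont.
- exact: isom_plus_comp.
- by move=> t t01 /=; rewrite e' ?e//; exact: m1'.
Qed.

Lemma wccE (A : set plane) (L : R) (f : R -> plane) : lip L f ->
  wcc A (path_class L f) = inf [set con A (s \o f) | s in isom_plus].
Proof.
move=> lf; rewrite /wcc; set g := get _.
have [_ [phi [psi [s [[m1 m2 [_ k2] _ _] i e]]]]] : path_class L f g.
  by apply: (@getPex (R -> R * R)); exists f; split => //; exact: path_equiv_refl.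
have conE t : con A (t \o g) = con A ((t \o s) \o f).
  congr sup; apply/seteqP; split => _ [x x01 <-] /=.
    by exists (phi x); [exact: m1|rewrite e].
  by exists (psi x); [exact: m2|rewrite e ?k2//; exact: m2].
congr inf; apply/seteqP; split => _ [t it <-].
  by exists (t \o s); [exact: isom_plus_comp|rewrite conE].
have [s' [is' k1 _]] := isom_plus_inv i.
exists (t \o s'); first exact: isom_plus_comp.
rewrite conE; congr con; apply/funext => x /=.
by rewrite k1.
Qed.

End Escape.

(* Main.v *)
(* A segment longer than 2 fits in neither disk, so it cannot avoid the
   boundary of A: L_1(A) <= 2.  On the other hand every path f of length at most
   L = 81/40 fits in A.  Let d be the distance between its endpoints.  If
   L + d <= 4, then f lies in a disk of radius 1.  Otherwise f is nearly straight
   in the direction e of its chord: k(t) = L t - <f(t), e> is nondecreasing and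
   grows by at most 1/20 in total.  Being small on average, the slopes of k from
   some time t0 near 1/2 are all small: |k(t) - k(t0)| <= |t - t0| / 2 for all t.
   Moving f(t0) to the origin and e to the horizontal direction then puts the two
   halves of f in the two disks. *)
Require Import Defs.
From mathcomp Require Import all_boot all_order all_algebra.
From mathcomp Require Import all_classical all_reals all_analysis.
From mathcomp Require Import lra.
Import Order.TTheory GRing.Theory Num.Theory.
Import numFieldNormedType.Exports.
Set Implicit Arguments.
Unset Strict Implicit.
Unset Printing Implicit Defensive.
Local Open Scope classical_set_scope.
Local Open Scope ring_scope.

(** * Slow points of monotone functions *)

(** Continuous induction. The local estimate just to the left of [sup E] puts [sup E] into [E]; just
    to its right it would give a larger element of [E], unless [sup E = b]. In both uses [sup E]
    itself is one of the two points compared. *)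
Lemma local_slope_global (R : realType) (S : R -> R) (a b c : R) : a <= b ->
    (forall t0, a <= t0 <= b -> exists2 eta, 0 < eta & forall t t',
      a <= t -> t <= t' -> t' <= b -> `|t - t0| < eta -> `|t' - t0| < eta ->
      c * (t' - t) <= S t' - S t) ->
  c * (b - a) <= S b - S a.
Proof.
move=> ab loc.
pose E := [set t | a <= t <= b /\ c * (t - a) <= S t - S a].
have Ea : E a by split; lra.
have ubE : ubound E b by move=> t [/andP[_ ?] _].
have supE : has_sup E by split; [exists a | exists b].
have a_le : a <= sup E by apply: ub_le_sup => //; exists b.
have le_b : sup E <= b by apply: ge_sup => //; exists a.
have [|eta eta0 h] := loc (sup E); first by apply/andP.
have [t [/andP[at_ tb] St] tgt] := sup_adherent eta0 supE.
have t_le : t <= sup E by apply: ub_le_sup; [exists b | split => //; apply/andP].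
have dt : `|t - sup E| < eta by rewrite ler0_norm; lra.
have d0 : `|sup E - sup E| < eta by rewrite subrr normr0.
have Esup : c * (sup E - a) <= S (sup E) - S a.
  by have := h t (sup E) at_ t_le le_b dt d0; lra.
have [<-//|] : sup E = b \/ sup E < b by move: le_b; rewrite le_eqVlt => /predU1P.
move=> ltb.
pose t' := Num.min b (sup E + eta / 2).
have t'b : t' <= b by rewrite ge_min lexx.
have t'gt : sup E < t' by rewrite lt_min ltb /=; lra.
have t'eta : t' <= sup E + eta / 2 by rewrite ge_min lexx orbT.
have dt' : `|t' - sup E| < eta by rewrite gtr0_norm; lra.
have := h (sup E) t' a_le (ltW t'gt) t'b d0 dt' => h'.
have : t' <= sup E.
  by apply: ub_le_sup; [exists b | split; [apply/andP; split; lra | lra]].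
lra.
Qed.

(** Take [K t] to be the supremum of [k s - c * (s - t)] over [t <= s <= 1], in the spirit of the
    rising sun lemma. If [k] rises from [t0] to some later [s] faster than slope [c], then for [t]
    near [t0] the points near [t0] can be ignored in this supremum, and every remaining term grows
    in [t] with slope [c]. *)
Lemma upper_slope_envelope (R : realType) (k : R -> R) (c D : R) :
    0 < c -> 0 <= D ->
    (forall s t, 0 <= s -> s <= t -> t <= 1 -> k s <= k t) ->
    (forall s t, 0 <= s -> s <= t -> t <= 1 -> k t - k s <= D * (t - s)) ->
  exists K : R -> R, [/\
    forall t s, 0 <= t -> t <= s -> s <= 1 -> k s - c * (s - t) <= K t,
    forall t t', 0 <= t -> t <= t' -> t' <= 1 -> K t <= K t',
    forall t, 0 <= t <= 1 -> K t <= k 1 &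
    forall t0 s, 0 <= t0 -> t0 <= s -> s <= 1 -> c * (s - t0) < k s - k t0 ->
      exists2 eta, 0 < eta & forall t t', 0 <= t -> t <= t' -> t' <= 1 ->
        `|t - t0| < eta -> `|t' - t0| < eta -> c * (t' - t) <= K t' - K t].
Proof.
move=> c0 D0 kmono klip.
pose V t := [set k s - c * (s - t) | s in [set s | t <= s <= 1]].
pose K t := sup (V t).
have ubV t : 0 <= t -> ubound (V t) (k 1).
  move=> t0 _ [s /= /andP[ts s1] <-].
  have : 0 <= c * (s - t) by apply: mulr_ge0; lra.
  have := kmono s 1; lra.
have V0 t : t <= 1 -> V t !=set0.
  by move=> t1; exists (k t - c * (t - t)); exists t => //=; rewrite lexx.
have K_ge t s : 0 <= t -> t <= s -> s <= 1 -> k s - c * (s - t) <= K t.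
  move=> t0 ts s1; apply: ub_le_sup; first by exists (k 1); apply: ubV.
  by exists s => //=; rewrite ts.
have K_le t z : t <= 1 -> (forall s, t <= s -> s <= 1 -> k s - c * (s - t) <= z) ->
    K t <= z.
  move=> t1 h; apply: ge_sup; first exact: V0.
  by move=> _ [s /= /andP[ts s1] <-]; apply: h.
exists K; split => //.
- move=> t t' t0 tt' t'1; apply: K_le => [|s ts s1]; first lra.
  have [t's|/ltW st'] := leP t' s.
    have := K_ge t' s; have : 0 <= c * (t' - t) by apply: mulr_ge0; lra.
    lra.
  have := K_ge t' t'; have := kmono s t'.
  have : 0 <= c * (s - t) by apply: mulr_ge0; lra.
  lra.
- by move=> t /andP[t0 t1]; apply: ge_sup; [exact: V0 | exact: ubV].
move=> t0 s t00 t0s s1 jump.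
have t0_lt : t0 < s.
  by rewrite lt_neqAle t0s andbT; apply/eqP => e; move: jump; rewrite e; lra.
pose g := k s - k t0 - c * (s - t0).
have g0 : 0 < g by rewrite /g; lra.
have Dc0 : 0 < D + c by lra.
(* The first bound keeps [r] to the left of [s]. The second keeps [k r - c * r] below its value at
   [s]: from [t0] to [r] it rises by at most [(D + c) * |r - t0|], which is less than [g]. *)
exists (Num.min (s - t0) (g / (D + c))).
  by rewrite lt_min subr_gt0 t0_lt divr_gt0.
have close r : 0 <= r -> r <= 1 -> `|r - t0| < Num.min (s - t0) (g / (D + c)) ->
    r < s /\ k r - c * r <= k s - c * s.
  move=> r0 r1; rewrite lt_min ltr_pdivlMr// => /andP[rs rg].
  split; first by have := ler_norm (r - t0); lra.
  have : k r - k t0 - c * (r - t0) <= `|r - t0| * (D + c).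
    have [rt|/ltW rt] := leP t0 r.
      have := klip t0 r; have : 0 <= c * (r - t0) by apply: mulr_ge0; lra.
      rewrite ger0_norm ?subr_ge0//; lra.
    have := kmono r t0; have : 0 <= D * (t0 - r) by apply: mulr_ge0; lra.
    rewrite ler0_norm ?subr_le0//; lra.
  by rewrite /g in rg; lra.
move=> t t' t_ge0 tt' t'1 dt dt'.
have [lt_t's _] := close t' (le_trans t_ge0 tt') t'1 dt'.
have : K t <= K t' - c * (t' - t); last lra.
apply: K_le => [|r tr r1]; first lra.
have [t'r|/ltW rt'] := leP t' r; first by have := K_ge t' r; lra.
(* A term with [r <= t'] is dominated by the term at [s], which lies beyond [t'] and so counts for
   [K t']. *)
have r_ge0 : 0 <= r by lra.
have dr : `|r - t0| < Num.min (s - t0) (g / (D + c)).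
  move: dt dt'; rewrite !ltr_norml => /andP[? _] /andP[_ ?].
  by apply/andP; split; lra.
have [_ kr] := close r r_ge0 r1 dr.
have := K_ge t' s; lra.
Qed.

(* Let K >= k >= J be the least nondecreasing majorant and the greatest
   nondecreasing minorant of k with slopes at most c.  A point where J = k = K is
   slow.  Where K > k or k > J, the slope of K or of J is c, so without a slow point
   J + K would grow by at least c (b - a) on [a, b]. *)
Lemma exists_slow_point (R : realType) (k : R -> R) (a b c D : R) :
    0 < c -> 0 <= D ->
    (forall s t, 0 <= s -> s <= t -> t <= 1 -> k s <= k t) ->
    (forall s t, 0 <= s -> s <= t -> t <= 1 -> k t - k s <= D * (t - s)) ->
    0 <= a -> a <= b -> b <= 1 -> 2 * (k 1 - k 0) < c * (b - a) ->
  exists2 t0, a <= t0 <= b &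
    forall t, 0 <= t <= 1 -> `|k t - k t0| <= c * `|t - t0|.
Proof.
move=> c0 D0 kmono klip a0 ab b1 small; apply: contrapT => none.
have [K [K1 K2 K3 K4]] := @upper_slope_envelope R k c D c0 D0 kmono klip.
have [|s t s0 st t1|K' [K'1 K'2 K'3 K'4]] :=
    @upper_slope_envelope R (fun t => - k (1 - t)) c D c0 D0.
- by move=> s t s0 st t1; rewrite lerN2; apply: kmono; lra.
- by have := klip (1 - t) (1 - s); lra.
(* By reflection [- K' (1 - t)] is [J t], so [S] is [J + K]. Both envelopes lie between [k 0] and
   [k 1] at [a] and [b], hence [S] grows by at most [2 * (k 1 - k 0)]. *)
pose S t := K t - K' (1 - t).
suff : c * (b - a) <= S b - S a.
  have := K1 a a; have := K'1 (1 - b) (1 - b); have := K3 b; have := K'3 (1 - a).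
  have := kmono 0 a; have := kmono b 1; rewrite /S !subrr !subKr !mulr0 !subr0.
  have -> : 0 <= b <= 1 by apply/andP; split; lra.
  have -> : 0 <= 1 - a <= 1 by apply/andP; split; lra.
  lra.
apply: local_slope_global => // t0 /andP[at0 t0b].
have [s /andP[s0 s1] bad] : exists2 s, 0 <= s <= 1 & c * `|s - t0| < `|k s - k t0|.
  apply: contrapT => nobad; apply: none; exists t0; first by apply/andP.
  by move=> t t01; rewrite leNgt; apply/negP => lt_t; apply: nobad; exists t.
(* A bad [s] to the right of [t0] makes [K] steep near [t0], one to the left makes [J] steep; the
   other envelope is nondecreasing. *)
have [t0s|/ltW st0] := leP t0 s.
  move: bad; rewrite !ger0_norm ?subr_ge0// => [bad|]; last by apply: kmono; lra.
  have [||||eta eta0 h] := K4 t0 s => //; first lra.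
  exists eta => // t t' at_ tt' t'b dt dt'.
  have := h t t'; have := K'2 (1 - t') (1 - t); rewrite dt dt' /S; lra.
move: bad; rewrite !ler0_norm ?subr_le0// => [bad|]; last by apply: kmono; lra.
have [||||eta eta0 h] := K'4 (1 - t0) (1 - s) => //; try lra.
  by rewrite !subKr; lra.
exists eta => // t t' at_ tt' t'b dt dt'.
have := h (1 - t') (1 - t); have := K2 t t'.
have e r : 1 - r - (1 - t0) = - (r - t0) by lra.
rewrite !e !normrN dt dt' /S; lra.
Qed.

(** * The Euclidean plane and its rigid motions *)

Lemma edist2_ge0 (R : realType) (p q : plane R) : 0 <= edist2 p q.
Proof. exact: sqrtr_ge0. Qed.

Lemma edist2_sqr (R : realType) (p q : plane R) :
  edist2 p q ^+ 2 = (p.1 - q.1) ^+ 2 + (p.2 - q.2) ^+ 2.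
Proof. by rewrite sqr_sqrtr// addr_ge0// sqr_ge0. Qed.

Lemma edist2_le (R : realType) (p q : plane R) (r : R) : 0 <= r ->
  (edist2 p q <= r) = ((p.1 - q.1) ^+ 2 + (p.2 - q.2) ^+ 2 <= r ^+ 2).
Proof. by move=> r0; rewrite -edist2_sqr ler_sqr// nnegrE ?edist2_ge0. Qed.

Lemma edist2C (R : realType) (p q : plane R) : edist2 p q = edist2 q p.
Proof. by congr Num.sqrt; lra. Qed.

Lemma edist2_triangle (R : realType) (q p r : plane R) :
  edist2 p r <= edist2 p q + edist2 q r.
Proof.
rewrite edist2_le ?addr_ge0 ?edist2_ge0//.
have inner : (p.1 - q.1) * (q.1 - r.1) + (p.2 - q.2) * (q.2 - r.2) <=
    edist2 p q * edist2 q r.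
  apply: le_trans (ler_norm _) _.
  rewrite -ler_sqr ?nnegrE ?mulr_ge0 ?edist2_ge0// real_normK ?num_real//.
  rewrite exprMn !edist2_sqr.
  have := sqr_ge0 ((p.1 - q.1) * (q.2 - r.2) - (p.2 - q.2) * (q.1 - r.1)).
  lra.
rewrite [leRHS]sqrrD !edist2_sqr; lra.
Qed.

Lemma edist2_midpoint (R : realType) (x p q : plane R) :
  edist2 ((p.1 + q.1) / 2, (p.2 + q.2) / 2) x <= (edist2 p x + edist2 q x) / 2.
Proof.
have e (u : plane R) : edist2 (p.1 + q.1, p.2 + q.2) u =
    2 * edist2 ((p.1 + q.1) / 2, (p.2 + q.2) / 2) (u.1 / 2, u.2 / 2).
  apply: (@pexpIrn _ 2) => //; rewrite ?nnegrE ?mulr_ge0 ?edist2_ge0//.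
  by rewrite exprMn !edist2_sqr /=; lra.
(* Doubling turns the midpoint into [p + q]; going to [2 x] through [x + q] changes one summand at a
   time. *)
have := edist2_triangle (x.1 + q.1, x.2 + q.2) (p.1 + q.1, p.2 + q.2) (2 * x.1, 2 * x.2).
rewrite e /= ![2 * _ / 2]mulrAC divff ?pnatr_eq0// !mul1r.
have -> : edist2 (p.1 + q.1, p.2 + q.2) (x.1 + q.1, x.2 + q.2) = edist2 p x.
  by congr Num.sqrt => /=; lra.
have -> : edist2 (x.1 + q.1, x.2 + q.2) (2 * x.1, 2 * x.2) = edist2 q x.
  by congr Num.sqrt => /=; lra.
have -> : (x.1, x.2) = x by case: x.
lra.
Qed.

Lemma inner_le_edist2 (R : realType) (e p q : plane R) :
  e.1 ^+ 2 + e.2 ^+ 2 = 1 ->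
  e.1 * (p.1 - q.1) + e.2 * (p.2 - q.2) <= edist2 p q.
Proof.
move=> e1; apply: le_trans (ler_norm _) _.
rewrite -ler_sqr ?nnegrE ?edist2_ge0// real_normK ?num_real// edist2_sqr.
rewrite -[leRHS]mul1r -e1.
have := sqr_ge0 (e.1 * (p.2 - q.2) - e.2 * (p.1 - q.1)).
lra.
Qed.

(* The rigid motion that sends q to c and the unit direction e to (1, 0). *)
Definition rigid (R : realType) (e q c p : plane R) : plane R :=
  (c.1 + e.1 * (p.1 - q.1) + e.2 * (p.2 - q.2),
   c.2 - e.2 * (p.1 - q.1) + e.1 * (p.2 - q.2)).

Lemma isom_plus_rigid (R : realType) (e q c : plane R) :
  e.1 ^+ 2 + e.2 ^+ 2 = 1 -> isom_plus (rigid e q c).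
Proof.
move=> e1; split.
- exists (rigid (e.1, - e.2) c q) => -[x y] /=; rewrite /rigid /=.
  + congr pair.
      transitivity (q.1 + (e.1 ^+ 2 + e.2 ^+ 2) * (x - q.1)); first lra.
      by rewrite e1; lra.
    transitivity (q.2 + (e.1 ^+ 2 + e.2 ^+ 2) * (y - q.2)); first lra.
    by rewrite e1; lra.
  + congr pair.
      transitivity (c.1 + (e.1 ^+ 2 + e.2 ^+ 2) * (x - c.1)); first lra.
      by rewrite e1; lra.
    transitivity (c.2 + (e.1 ^+ 2 + e.2 ^+ 2) * (y - c.2)); first lra.
    by rewrite e1; lra.
- move=> u v; congr Num.sqrt.
  rewrite -[RHS]mul1r -e1 /rigid /=; lra.
- move=> u v w; congr Num.sg.
  rewrite -[RHS]mul1r -e1 /orient /rigid /=; lra.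
Qed.

(** * Covering short paths by disks *)

Lemma lip_edist2 (R : realType) (L : R) (f : R -> plane R) : lip L f ->
  forall s t, 0 <= s -> s <= t -> t <= 1 -> edist2 (f s) (f t) <= L * (t - s).
Proof.
move=> lf s t s0 st t1; rewrite -[t - s]ger0_norm ?subr_ge0// distrC.
by apply: lf; rewrite /= in_itv /=; apply/andP; split; lra.
Qed.

(* Closing up f by the segment from f 1 to f 0 gives a closed curve of length
   at most L + d; the disk centered at the midpoint of two points halving this
   curve covers it. *)
Lemma lip_covered_by_disk (R : realType) (L r : R) (f : R -> plane R) :
    0 < L -> lip L f -> L + edist2 (f 0) (f 1) <= 4 * r ->
  exists c : plane R, forall t, 0 <= t <= 1 -> edist2 c (f t) <= r.
Proof.
move=> L0 /lip_edist2 lf; set d := edist2 _ _ => Ld.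
have dL : d <= L by have := lf 0 1; rewrite -/d; lra.
have d0 : 0 <= d by exact: edist2_ge0.
(* The two arcs of the closed curve between [f a] and [f (1 - a)] have lengths at most
   [L * (1 - 2 * a)] and [2 * L * a + d]; this [a] makes both bounds equal to [(L + d) / 2]. *)
pose a := (L - d) / (4 * L).
have La : 4 * (L * a) = L - d.
  by rewrite mulrA mulrC divfK// mulf_neq0 ?pnatr_eq0// gt_eqF.
have a0 : 0 <= a by apply: divr_ge0; lra.
have a_half : 2 * a <= 1 by rewrite -(ler_pM2l L0); lra.
have a1 : a <= 1 - a by lra.
exists (((f a).1 + (f (1 - a)).1) / 2, ((f a).2 + (f (1 - a)).2) / 2).
move=> t /andP[t0 t1]; apply: le_trans (edist2_midpoint _ _ _) _.
suff : edist2 (f a) (f t) + edist2 (f (1 - a)) (f t) <= (L + d) / 2 by lra.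
have [ta|/ltW at_] := leP t a.
  have := edist2_triangle (f 1) (f (1 - a)) (f t).
  have := edist2_triangle (f 0) (f 1) (f t).
  have := lf t a t0 ta; have := lf 0 t; have := lf (1 - a) 1.
  rewrite [edist2 (f 1) (f 0)]edist2C -/d [edist2 (f a) _]edist2C; lra.
have [ta|/ltW ta] := leP t (1 - a).
  have := lf a t a0 at_ t1; have := lf t (1 - a).
  rewrite [edist2 (f (1 - a)) _]edist2C; lra.
have := edist2_triangle (f 0) (f a) (f t).
have := edist2_triangle (f 1) (f 0) (f t).
have := lf (1 - a) t; have := lf 0 a; have := lf t 1.
rewrite -/d [edist2 (f a) (f 0)]edist2C [edist2 (f 1) _]edist2C; lra.
Qed.

Definition tangent_disks (R : realType) : set (plane R) :=
  cdisk (- 1, 0) 1 `|` cdisk (1, 0) 1.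

Arguments tangent_disks : clear implicits.

Lemma lip_covered_by_tangent_disks (R : realType) (f : R -> plane R) :
    lip (81 / 40) f ->
  exists2 s, isom_plus s & forall t, 0 <= t <= 1 ->
    tangent_disks R (s (f t)).
Proof.
move=> lf; set L : R := 81 / 40 in lf.
have L0 : 0 < L by rewrite /L; lra.
have [short|long] := leP (L + edist2 (f 0) (f 1)) (4 * 1).
  have [c hc] := lip_covered_by_disk L0 lf short.
  exists (rigid (1, 0) c (1, 0)); first by apply: isom_plus_rigid => /=; lra.
  move=> t /hc; rewrite edist2_le// => h; right.
  by rewrite /cdisk /= edist2_le// /rigid /=; lra.
have {}lf := lip_edist2 lf.
set d := edist2 (f 0) (f 1) in long.
have d_gt : 79 / 40 < d by move: long; rewrite /L; lra.
have d_neq0 : d != 0 by lra.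
pose e : plane R := (((f 1).1 - (f 0).1) / d, ((f 1).2 - (f 0).2) / d).
have sqd : d ^+ 2 = ((f 1).1 - (f 0).1) ^+ 2 + ((f 1).2 - (f 0).2) ^+ 2.
  by rewrite /d edist2_sqr; lra.
have e1 : e.1 ^+ 2 + e.2 ^+ 2 = 1.
  by rewrite /e /= !expr_div_n -mulrDl -sqd divff// expf_neq0.
have ed : e.1 * ((f 1).1 - (f 0).1) + e.2 * ((f 1).2 - (f 0).2) = d.
  rewrite /e /= ![_ / d * _]mulrAC -mulrDl -!expr2 -sqd.
  by rewrite expr2 mulfK.
pose k t := L * t - (e.1 * (f t).1 + e.2 * (f t).2).
have kmono s t : 0 <= s -> s <= t -> t <= 1 -> k s <= k t.
  move=> s0 st t1; have := lf s t s0 st t1.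
  by have := inner_le_edist2 (f t) (f s) e1; rewrite /k edist2C; lra.
have klip s t : 0 <= s -> s <= t -> t <= 1 -> k t - k s <= (2 * L) * (t - s).
  move=> s0 st t1; have := lf s t s0 st t1.
  by have := inner_le_edist2 (f s) (f t) e1; rewrite /k; lra.
(* Since [k 1 - k 0 = L - d < 1/20], twice the growth is below [1/10], while [c * (b - a) = 1/8]. *)
have [||||||t0 /andP[t0_ge t0_le] slow] :=
  @exists_slow_point R k (3 / 8) (5 / 8) (1 / 2) (2 * L) _ _ kmono klip; try lra.
  by rewrite /k /L; lra.
exists (rigid e (f t0) (0, 0)); first exact: isom_plus_rigid.
move=> t /andP[t_ge0 t_le1].
have := slow t; rewrite t_ge0 t_le1 => /(_ isT).
pose X := e.1 * ((f t).1 - (f t0).1) + e.2 * ((f t).2 - (f t0).2).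
pose Y := - e.2 * ((f t).1 - (f t0).1) + e.1 * ((f t).2 - (f t0).2).
have XY : X ^+ 2 + Y ^+ 2 = edist2 (f t) (f t0) ^+ 2.
  by rewrite edist2_sqr -[RHS]mul1r -e1 /X /Y; lra.
have kX : k t - k t0 = L * (t - t0) - X by rewrite /k /X; lra.
(* With [u = |t - t0|], slowness gives [|X| >= (L - 1/2) * u], and the disks require
   [X ^+ 2 + Y ^+ 2 <= 2 * |X|]. It suffices that [L ^+ 2 * u <= 2 * L - 1], which holds up to
   [u = 5/8], the largest distance from a point of [[3/8, 5/8]] to a point of [[0, 1]]. *)
have sqd_le (u : R) : 0 <= u -> u <= 5 / 8 -> edist2 (f t) (f t0) <= L * u ->
    edist2 (f t) (f t0) ^+ 2 <= 2 * (L * u - u / 2).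
  move=> u0 u58 h; have : edist2 (f t) (f t0) ^+ 2 <= (L * u) ^+ 2.
    by rewrite ler_sqr ?nnegrE ?edist2_ge0 ?mulr_ge0//; lra.
  have : 0 <= u * (5 / 8 - u) by apply: mulr_ge0; lra.
  rewrite /L; lra.
have [tt0|/ltW t0t] := leP t t0.
  rewrite !ler0_norm ?subr_le0//; last by apply: kmono; lra.
  rewrite kX => slow_t; left; rewrite /cdisk /= edist2_le// /rigid /=.
  have : X ^+ 2 + Y ^+ 2 <= 2 * (L * (t0 - t) - (t0 - t) / 2).
    by rewrite XY; apply: sqd_le; [lra | lra | apply: lf; lra].
  have -> : (- 1 - (0 + e.1 * ((f t).1 - (f t0).1) + e.2 * ((f t).2 - (f t0).2))) ^+ 2 +
      (0 - (0 - e.2 * ((f t).1 - (f t0).1) + e.1 * ((f t).2 - (f t0).2))) ^+ 2 =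
      X ^+ 2 + Y ^+ 2 + 2 * X + 1 by rewrite /X /Y; lra.
  lra.
rewrite !ger0_norm ?subr_ge0//; last by apply: kmono; lra.
rewrite kX => slow_t; right; rewrite /cdisk /= edist2_le// /rigid /=.
have : X ^+ 2 + Y ^+ 2 <= 2 * (L * (t - t0) - (t - t0) / 2).
  by rewrite XY; apply: sqd_le; [lra | lra | rewrite edist2C; apply: lf; lra].
have -> : (1 - (0 + e.1 * ((f t).1 - (f t0).1) + e.2 * ((f t).2 - (f t0).2))) ^+ 2 +
    (0 - (0 - e.2 * ((f t).1 - (f t0).1) + e.1 * ((f t).2 - (f t0).2))) ^+ 2 =
    X ^+ 2 + Y ^+ 2 - 2 * X + 1 by rewrite /X /Y; lra.
lra.
Qed.

(** * Signed distance to a set *)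

Lemma dist_set_le (R : realType) (B : set (plane R)) (x y : plane R) :
  B y -> dist_set x B <= edist2 x y.
Proof.
move=> By; apply: ge_inf; last by exists y.
by exists 0 => _ [z _ <-]; exact: edist2_ge0.
Qed.

Lemma dist_set_ge (R : realType) (B : set (plane R)) (x : plane R) (r : R) :
  B !=set0 -> (forall y, B y -> r <= edist2 x y) -> r <= dist_set x B.
Proof.
move=> [y By] h; apply: lb_le_inf; first by exists (edist2 x y); exists y.
by move=> _ [z Bz <-]; exact: h.
Qed.

Lemma dist_set_ge0 (R : realType) (B : set (plane R)) (x : plane R) :
  B !=set0 -> 0 <= dist_set x B.
Proof. by move=> B0; apply: dist_set_ge => // y _; exact: edist2_ge0. Qed.

Lemma sdist_le (R : realType) (A : set (plane R)) (x y : plane R) :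
  bnd A y -> sdist A x <= edist2 x y.
Proof.
move=> By; rewrite /sdist; have := dist_set_le x By.
have /(dist_set_ge0 x) : bnd A !=set0 by exists y.
by case: ifP; lra.
Qed.

Lemma sdist_le0 (R : realType) (A : set (plane R)) (x : plane R) :
  bnd A !=set0 -> A x -> sdist A x <= 0.
Proof. by move=> /(dist_set_ge0 x) d0 /mem_set Ax; rewrite /sdist Ax; lra. Qed.

Lemma sdist_out (R : realType) (A : set (plane R)) (x : plane R) :
  ~ A x -> sdist A x = dist_set x (bnd A).
Proof. by move=> Ax; rewrite /sdist memNset. Qed.

Lemma sdist_ge (R : realType) (A : set (plane R)) (x y : plane R) (r : R) :
  bnd A y -> 0 <= r -> (A x -> edist2 x y <= r) -> - r <= sdist A x.
Proof.
move=> By r0 h; have [Ax|Ax] := pselect (A x).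
  rewrite /sdist mem_set//; have := dist_set_le x By; have := h Ax; lra.
rewrite sdist_out//; have /(dist_set_ge0 x) : bnd A !=set0 by exists y.
lra.
Qed.

(* The last hypothesis covers the junk value sup E = 0 of an unbounded E. *)
Lemma sup_ge_elem (R : realType) (E : set R) (x z : R) :
  E x -> z <= x -> z <= 0 -> z <= sup E.
Proof.
move=> Ex zx z0; have [supE|/sup_out ->//] := pselect (has_sup E).
by apply: le_trans zx _; apply: ub_le_sup => //; case: supE.
Qed.

(** * Bounds for the tangent disks *)

Lemma tangent_disks_edist2 (R : realType) (x : plane R) :
  tangent_disks R x -> edist2 x (0, 0) <= 2.
Proof.
move=> [] /= Ax; [have := edist2_triangle (- 1, 0) x (0, 0)
                 | have := edist2_triangle (1, 0) x (0, 0)].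
  have : edist2 (- 1, 0) (0, 0) <= 1 :> R by rewrite edist2_le//=; lra.
  by move: Ax; rewrite /cdisk /= edist2C; lra.
have : edist2 (1, 0) (0, 0) <= 1 :> R by rewrite edist2_le//=; lra.
by move: Ax; rewrite /cdisk /= edist2C; lra.
Qed.

Lemma bnd_tangent_disks0 (R : realType) : bnd (tangent_disks R) (0, 0).
Proof.
split.
  by apply: subset_closure; left; rewrite /cdisk /= edist2_le//=; lra.
(* The points [(0, r / 2)] of the common tangent line lie outside both disks and tend to the
   origin. *)
move=> /= /nbhs_ballP[r /= r0 /(_ (0, r / 2))].
have b : ball ((0, 0) : R * R) r (0, r / 2).
  split => /=; first exact: ballxx.
  by rewrite /ball /= sub0r normrN gtr0_norm; lra.
have : 0 < r * r by apply: mulr_gt0.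
by move=> rr /(_ b)[] /=; rewrite /cdisk /= edist2_le//=; lra.
Qed.

Lemma bnd_tangent_disks_neq0 (R : realType) : bnd (tangent_disks R) !=set0.
Proof. by exists (0, 0); exact: bnd_tangent_disks0. Qed.

Lemma bnd_tangent_disks_edist2 (R : realType) (y : plane R) :
  bnd (tangent_disks R) y -> edist2 y (0, 0) <= 4.
Proof.
move=> [cy _]; have [z [Az [/= z1 z2]]] := cy _ (nbhsx_ballx (y : R * R) 1 ltr01).
have := edist2_triangle z y (0, 0); have := tangent_disks_edist2 Az.
suff : edist2 y z <= 2 by lra.
(* Balls of the product are squares, so each coordinate of [y] and [z] differs by at most 1. *)
move: z1 z2; rewrite /ball /= => /ltW z1 /ltW z2.
rewrite edist2_le//.
have sq (u : R) : `|u| <= 1 -> u ^+ 2 <= 1.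
  by rewrite -real_normK ?num_real// => u1; rewrite expr_le1.
have := sq _ z1; have := sq _ z2; lra.
Qed.

Lemma sdist_tangent_disks_le (R : realType) (x : plane R) :
  sdist (tangent_disks R) x <= edist2 x (0, 0).
Proof. exact/sdist_le/bnd_tangent_disks0. Qed.

(** Makes the infimum in [wcc] one of a set bounded below. The origin is a boundary point within 2
    of every point of the disks. *)
Lemma con_tangent_disks_ge (R : realType) (f : R -> plane R) :
  - 2 <= con (tangent_disks R) f.
Proof.
apply: (@sup_ge_elem _ _ (sdist (tangent_disks R) (f 0))); last lra.
  by exists 0 => //=; rewrite in_itv /= lexx ler01.
by apply: (sdist_ge (@bnd_tangent_disks0 R)); [lra | exact: tangent_disks_edist2].
Qed.

Lemma con_le (R : realType) (A : set (plane R)) (f : R -> plane R) (z : R) :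
  (forall t, 0 <= t <= 1 -> sdist A (f t) <= z) -> con A f <= z.
Proof.
move=> h; apply: ge_sup => [|_ [t t01 <-]].
  by exists (sdist A (f 0)); exists 0 => //=; rewrite in_itv /= lexx ler01.
by apply: h; move: t01; rewrite /= in_itv.
Qed.

Lemma wcc_tangent_disks_le (R : realType) (L : R) (f : R -> plane R)
    (s : plane R -> plane R) : lip L f -> isom_plus s ->
  wcc (tangent_disks R) (path_class L f) <= con (tangent_disks R) (s \o f).
Proof.
move=> lf is_; rewrite wccE//; apply: ge_inf; last by exists s.
by exists (- 2) => _ [s' _ <-]; exact: con_tangent_disks_ge.
Qed.

(** Makes the supremum in [esc] one of a set bounded above. Moving [f 0] to the origin, a boundary
    point, keeps the whole path within [L] of the boundary. *)
Lemma wcc_tangent_disks_bounded (R : realType) (L : R) (f : R -> plane R) :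
  lip L f -> wcc (tangent_disks R) (path_class L f) <= L.
Proof.
move=> lf; have is_ : isom_plus (rigid (1, 0) (f 0) (0, 0)).
  by apply: isom_plus_rigid => /=; lra.
apply: le_trans (wcc_tangent_disks_le lf is_) _.
apply: con_le => t /andP[t0 t1] /=.
apply: le_trans (sdist_tangent_disks_le _) _.
have -> : edist2 (rigid (1, 0) (f 0) (0, 0) (f t)) (0, 0) = edist2 (f t) (f 0).
  by congr Num.sqrt; rewrite /rigid /=; lra.
have := lip_edist2 lf (lexx 0) t0 t1; have := edist2_ge0 (f 0) (f t).
rewrite edist2C.
have [L0|L0] := leP 0 L.
  have : 0 <= L * (1 - t) by apply: mulr_ge0; lra.
  lra.
(* No path is [L]-Lipschitz for negative [L]. *)
by have := lip_edist2 lf (lexx 0) ler01 (lexx 1);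
   have := edist2_ge0 (f 0) (f 1); lra.
Qed.

Lemma esc_tangent_disks_ge (R : realType) (L z : R) (f : R -> plane R) :
    lip L f ->
    (forall s, isom_plus s -> z <= con (tangent_disks R) (s \o f)) ->
  z <= esc (tangent_disks R) L.
Proof.
move=> lf h; apply: le_trans (_ : z <= wcc (tangent_disks R) (path_class L f)) _.
  rewrite wccE//; apply: lb_le_inf => [|_ [s is_ <-]]; last exact: h.
  by exists (con (tangent_disks R) (id \o f)); exists id => //; exact: isom_plus_id.
apply: ub_le_sup; last by exists (path_class L f) => //; exists f.
by exists L => _ [_ [g lg <-] <-]; exact: wcc_tangent_disks_bounded.
Qed.

(** * Segments as test paths *)

Definition hseg (R : realType) (L : R) (t : R) : plane R := (L * t, 0).

Lemma edist2_hseg (R : realType) (L s t : R) : 0 <= L ->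
  edist2 (hseg L s) (hseg L t) = L * `|s - t|.
Proof.
move=> L0; rewrite -[L in RHS]ger0_norm// -normrM -sqrtr_sqr.
by congr Num.sqrt => /=; lra.
Qed.

Lemma lip_hseg (R : realType) (L : R) : 0 <= L -> lip L (hseg L).
Proof. by move=> L0 s t _ _; rewrite edist2_hseg. Qed.

(** Shows that the set defining [L2] is nonempty, as the infimum of the empty set would be 0. One
    end of a segment of length 20 is at least 10 away from the origin, and the boundary stays within
    4 of it, which leaves 6. *)
Lemma esc_tangent_disks_gt0 (R : realType) : 0 < esc (tangent_disks R) 20.
Proof.
apply: (@lt_le_trans _ _ 6); first lra.
have L0 : (0 : R) <= 20 by lra.
apply: (esc_tangent_disks_ge (lip_hseg L0)) => s [_ ds _].
have d20 : edist2 (s (hseg 20 0)) (s (hseg 20 1)) = 20.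
  by rewrite ds edist2_hseg// sub0r normrN normr1 mulr1.
have [t t01 far] : exists2 t, 0 <= t <= 1 & 10 <= edist2 (s (hseg 20 t)) (0, 0).
  have := edist2_triangle (0, 0) (s (hseg 20 0)) (s (hseg 20 1)).
  rewrite d20 [edist2 (0, 0) _]edist2C => tri.
  have [?|?] := leP 10 (edist2 (s (hseg 20 0)) (0, 0)).
    by exists 0 => //; rewrite lexx ler01.
  by exists 1; [rewrite lexx ler01 | lra].
apply: (@le_trans _ _ (sdist (tangent_disks R) (s (hseg 20 t)))).
  rewrite sdist_out; last by move=> /tangent_disks_edist2; lra.
  apply: dist_set_ge => [|y /bnd_tangent_disks_edist2 y4].
    exact: bnd_tangent_disks_neq0.
  by have := edist2_triangle y (s (hseg 20 t)) (0, 0); lra.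
apply: ub_le_sup; last by exists t => //=; rewrite in_itv.
exists (20 + edist2 (s (hseg 20 0)) (0, 0)) => _ [u u01 <-] /=.
apply: le_trans (sdist_tangent_disks_le _) _.
have := edist2_triangle (s (hseg 20 0)) (s (hseg 20 u)) (0, 0).
move: u01; rewrite ds edist2_hseg// subr0 /= in_itv /= => /andP[u0 u1].
rewrite ger0_norm//; lra.
Qed.

Lemma continuous_isom_hseg (R : realType) (L : R) (s : plane R -> plane R) :
  0 < L -> isom_plus s -> continuous (fun t => (s (hseg L t)).1).
Proof.
move=> L0 [_ ds _] t; apply/cvgrPdist_lt => eps eps0.
near=> u.
have : `|t - u| < eps / L.
  by near: u; apply/nbhs_ballP; exists (eps / L) => //=; exact: divr_gt0.
rewrite ltr_pdivlMr// => tu.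
apply: le_lt_trans tu; rewrite mulrC -edist2_hseg; last exact: ltW.
rewrite -ds.
rewrite -ler_sqr ?nnegrE ?edist2_ge0// real_normK ?num_real// edist2_sqr.
by rewrite lerDl sqr_ge0.
Unshelve. all: by end_near. Qed.

Lemma tangent_disks_pos (R : realType) (x : plane R) :
  tangent_disks R x -> 0 <= x.1 -> cdisk (1, 0) 1 x.
Proof. by move=> [] //; rewrite /cdisk /= !edist2_le//=; lra. Qed.

Lemma tangent_disks_neg (R : realType) (x : plane R) :
  tangent_disks R x -> x.1 <= 0 -> cdisk (- 1, 0) 1 x.
Proof. by move=> [] //; rewrite /cdisk /= !edist2_le//=; lra. Qed.

(* A connected subset of the interior of the two disks avoids the origin, hence
   lies in one of them. *)
Lemma hseg_not_inside (R : realType) (L : R) (s : plane R -> plane R) :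
    2 < L -> isom_plus s ->
  exists2 t, 0 <= t <= 1 & 0 <= sdist (tangent_disks R) (s (hseg L t)).
Proof.
move=> L2 is_; apply: contrapT => none.
have inside t : 0 <= t <= 1 -> sdist (tangent_disks R) (s (hseg L t)) < 0.
  by move=> t01; rewrite ltNge; apply/negP => ?; apply: none; exists t.
have inA t : 0 <= t <= 1 -> tangent_disks R (s (hseg L t)).
  move=> /inside; apply: contraPP => nA; rewrite sdist_out//.
  by have := dist_set_ge0 (s (hseg L t)) (@bnd_tangent_disks_neq0 R); lra.
pose g t := (s (hseg L t)).1.
(* The disks meet the line [x = 0] only at the origin, where the signed distance is not negative. *)
have g_neq0 t : 0 <= t <= 1 -> g t != 0.
  move=> t01; apply/eqP => gt0.
  suff e : s (hseg L t) = (0, 0).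
    have := inside t t01.
    have := @sdist_ge _ _ (s (hseg L t)) (0, 0) 0 (@bnd_tangent_disks0 R).
    have -> : edist2 (s (hseg L t)) (0, 0) <= 0 by rewrite e edist2_le//=; lra.
    lra.
  have := tangent_disks_pos (inA t t01); rewrite -/(g t) gt0 lexx => /(_ isT).
  rewrite /cdisk /= edist2_le//= -/(g t) gt0 => h.
  have : (s (hseg L t)).2 ^+ 2 = 0.
    by have := sqr_ge0 (s (hseg L t)).2; lra.
  move/eqP; rewrite sqrf_eq0 => /eqP; move: gt0; rewrite /g.
  by case: (s _) => a b /= -> ->.
have i0 : 0 <= (0 : R) <= 1 by rewrite lexx ler01.
have i1 : 0 <= (1 : R) <= 1 by rewrite ler01 lexx.
have L0 : 0 <= L by lra.
have dL : edist2 (s (hseg L 0)) (s (hseg L 1)) = L.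
  by case: is_ => _ -> _; rewrite edist2_hseg// sub0r normrN normr1 mulr1.
have in_disk c : cdisk c 1 (s (hseg L 0)) -> cdisk c 1 (s (hseg L 1)) -> False.
  rewrite /cdisk /= => h0 h1.
  have := edist2_triangle c (s (hseg L 0)) (s (hseg L 1)).
  rewrite dL [edist2 _ c]edist2C; lra.
(* Ends on the same side share a disk of diameter [2 < L]; ends on opposite sides force a zero of
   [g]. *)
have [pos0|neg0] := leP 0 (g 0); have [pos1|neg1] := leP 0 (g 1).
- by apply: (@in_disk (1, 0)); apply: tangent_disks_pos => //; exact: inA.
- have [||c] := @IVT R g 0 1 0 ler01.
  + by apply: continuous_subspaceT; apply: continuous_isom_hseg => //; lra.
  + by rewrite ge_min le_max pos0 (ltW neg1) orbT.
  by rewrite in_itv /= => /g_neq0 /eqP.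
- have [||c] := @IVT R g 0 1 0 ler01.
  + by apply: continuous_subspaceT; apply: continuous_isom_hseg => //; lra.
  + by rewrite ge_min le_max pos1 (ltW neg0) orbT.
  by rewrite in_itv /= => /g_neq0 /eqP.
- by apply: (@in_disk (- 1, 0)); apply: tangent_disks_neg (ltW _) => //; exact: inA.
Qed.

(** * The sign of [esc] and the two thresholds *)

Lemma esc_tangent_disks_ge0 (R : realType) (L : R) :
  2 < L -> 0 <= esc (tangent_disks R) L.
Proof.
move=> L2; have L0 : 0 <= L by lra.
apply: (esc_tangent_disks_ge (lip_hseg L0)) => s is_.
have [t t01 d0] := hseg_not_inside L2 is_.
by apply: sup_ge_elem d0 (lexx 0); exists t => //=; rewrite in_itv.
Qed.

Lemma esc_tangent_disks_le0 (R : realType) (L : R) :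
  0 <= L -> L <= 81 / 40 -> esc (tangent_disks R) L <= 0.
Proof.
move=> L0 Lle; apply: ge_sup => [|_ [_ [f lf <-] <-]].
  exists (wcc (tangent_disks R) (path_class L (hseg L))).
  by exists (path_class L (hseg L)) => //; exists (hseg L) => //; exact: lip_hseg.
have [|s is_ hs] := @lip_covered_by_tangent_disks R f.
  move=> u t u01 t01; apply: le_trans (lf u t u01 t01) _.
  by apply: ler_wpM2r.
apply: le_trans (wcc_tangent_disks_le lf is_) _.
by apply: con_le => t /hs; apply: sdist_le0; exact: bnd_tangent_disks_neq0.
Qed.

Theorem theorem4p8 (R : realType) :
  let A : set (plane R) := cdisk (- 1, 0) 1 `|` cdisk (1, 0) 1 in
  L1 A < L2 A.
Proof.
suff : L1 (tangent_disks R) < L2 (tangent_disks R) by [].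
apply: (@le_lt_trans _ _ 2).
  have [[l El]|E0] :=
      pselect ([set l | 0 <= l /\ esc (tangent_disks R) l < 0] !=set0).
    apply: ge_sup => [|l' [_ esc_lt0]]; first by exists l.
    by rewrite leNgt; apply/negP => /esc_tangent_disks_ge0; lra.
  (* The supremum of the empty set is 0. *)
  by rewrite /L1 sup_out ?ler0n// => -[].
apply: (@lt_le_trans _ _ (81 / 40)); first lra.
apply: lb_le_inf => [|l [l0 esc_gt0]].
  by exists 20; split; [lra | exact: esc_tangent_disks_gt0].
rewrite leNgt; apply/negP => /ltW /(esc_tangent_disks_le0 l0); lra.
Qed.
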